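(* Let $\mathcal M^*:\mathbb C[t]\to\mathbb C[x]$ be the linear isomorphism with $\mathcal M^*(t^n)=(x)_n$ for all $n\ge0$. The following systems are mapped to each other by $\mathcal M^*$: (i) The $d$-orthogonal Appell polynomials are mapped to $(d+1)$-orthogonal Charlier-Appell polynomials. In particular, the images of the classical Hermite polynomials are $2$-orthogonal polynomials. The Charlier polynomials are obtained from the first (trivial) member of the Appell family, i.e. the one with $L=x\partial_x+a\partial_x$. (ii) The classical Laguerre polynomials are mapped onto the Meixner polynomials.
   Context: $\Delta f(x)=f(x+1)-f(x)$, $\nabla f(x)=f(x-1)-f(x)$; $(x)_n=x(x-1)\cdots(x-n+1)$, $(x)_0=1$. Exponentials of degree-lowering operators are defined by their (finite) exponential series. The map $\mathcal M^*$ originates from a modified Mellin transform. A system of monic polynomials $P_n$, $\deg P_n=n$, $n\ge0$, is called $d$-orthogonal if it satisfies a recurrence $xP_n(x)=P_{n+1}(x)+\sum_{j=0}^d\gamma_j(n)P_{n-j}(x)$ with constants $\gamma_j(n)$ independent of $x$ and $\gamma_d(n)\ne0$ for $n\ge d$ (with $P_k=0$ for $k<0$). For a polynomial $q$ without constant term, the Appell polynomials are $e^{q(\partial_x)}x^n$, $n\ge0$ (eigenfunctions of $L=x\partial_x+q'(\partial_x)\partial_x$), and the Charlier-Appell polynomials are $e^{q(\Delta)}(x)_n$, $n\ge0$. The member with $L=x\partial_x+a\partial_x$ is the one with $q(\partial_x)=a\partial_x$, $a\in\mathbb C$. The classical families are understood as polynomial eigenfunctions ($\deg P_n=n$): Hermite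 polynomials, of $-\partial_x^2+x\partial_x$; Laguerre polynomials (parameter $\alpha$), of $-x\partial_x^2-(\alpha+1-x)\partial_x$; Charlier polynomials (parameter $\rho$), of $\rho\Delta+x\nabla$; Meixner polynomials (parameters $\beta,c$), of $c(x+\beta)\Delta+x\nabla$. *)

(* Defs.v *)
From HB Require Import structures.
From mathcomp Require Import all_boot all_order all_algebra.

Set Implicit Arguments.
Unset Strict Implicit.
Unset Printing Implicit Defensive.

Import GRing.Theory.
Local Open Scope ring_scope.

Section Operators.
Variable F : fieldType.
Implicit Types (p q : {poly F}) (A D L : {poly F} -> {poly F})
  (P : nat -> {poly F}).

Definition fwd_diff p : {poly F} := p \Po ('X + 1) - p.

(* Note the sign: f(x - 1) - f(x), not f(x) - f(x - 1). *)
Definition bwd_diff p : {poly F} := p \Po ('X - 1) - p.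

(* (x)_n = x (x - 1) ... (x - n + 1) *)
Definition falling (n : nat) : {poly F} := \prod_(i < n) ('X - i%:R%:P).

(* The operator q(D). *)
Definition op_poly q D p : {poly F} := \sum_(i < size q) q`_i *: iter i D p.

(* e^A = \sum_k A^k / k!, for an operator A that lowers degrees: then
   A^k p = 0 as soon as k >= size p, so that the sum below is the whole
   exponential series. *)
Definition op_exp A p : {poly F} :=
  \sum_(k < size p) (k`!%:R)^-1 *: iter k A p.

Definition appell q (n : nat) : {poly F} :=
  op_exp (op_poly q (@deriv F)) 'X^n.

Definition charlier_appell q (n : nat) : {poly F} :=
  op_exp (op_poly q fwd_diff) (falling n).

(* The condition j <= n encodes the convention P_k = 0 for k < 0. *)
Definition d_orthogonal (d : nat) P : Prop :=
  (forall n, P n \is monic /\ size (P n) = n.+1) /\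
  exists gamma : nat -> nat -> F,
    (forall n, 'X * P n =
       P n.+1 + \sum_(j < d.+1 | (j <= n)%N) gamma j n *: P (n - j)%N) /\
    (forall n, (d <= n)%N -> gamma d n != 0).

Definition eigen_system L P : Prop :=
  forall n, size (P n) = n.+1 /\ exists lambda : F, L (P n) = lambda *: P n.

Definition monic_of p : {poly F} := (lead_coef p)^-1 *: p.

Definition hermite_op p : {poly F} := - p^`(2) + 'X * p^`().

Definition laguerre_op (alpha : F) p : {poly F} :=
  - ('X * p^`(2)) - ((alpha + 1)%:P - 'X) * p^`().

Definition charlier_op (rho : F) p : {poly F} :=
  rho *: fwd_diff p + 'X * bwd_diff p.

Definition meixner_op (beta c : F) p : {poly F} :=
  c *: (('X + beta%:P) * fwd_diff p) + 'X * bwd_diff p.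

End Operators.

Arguments falling {F} n.

(* Main.v *)
(** The map [M] turns [d/dx] into the forward difference [Delta], multiplication
    by [t] into [f(x) |-> x f(x - 1)], and preserves degrees and leading
    coefficients; hence it turns [e^(q(D)) x^n] into [e^(q(Delta)) (x)_n],
    [t D] into [- x nabla] and [t D^2] into [x (Delta + nabla)], which matches
    the eigenvalue problems (Laguerre in the variable [s t] with Meixner).
    The commutation of [e^(q(D))] with [x] gives
    [x P_n = P_(n+1) - q'(D) P_n] for [P_n = e^(q(D)) x^n], and multiplication by [x] corresponds to
    [t (1 + D)] under [M]; so both recurrences are explicit, and
    [d]-orthogonality of [P_n] and [(d+1)]-orthogonality of [M P_n] both say
    that [q] has degree [d + 1]. *)
From HB Require Import structures.
Require Import Defs.
From mathcomp Require Import all_boot all_order all_algebra.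
From mathcomp Require Import reals.
From mathcomp.real_closed Require Import complex.
From mathcomp Require Import ring.

Set Implicit Arguments.
Unset Strict Implicit.
Unset Printing Implicit Defensive.

Import GRing.Theory.
Local Open Scope ring_scope.
Local Open Scope complex_scope.

(** * Operators [q(D)] in the derivative *)

Section DerivativeOperators.
Variable F : numFieldType.
Implicit Types p q : {poly F}.

Lemma polyE_widen N p : (size p <= N)%N -> p = \sum_(i < N) p`_i *: 'X^i.
Proof.
move=> sp; rewrite -poly_def; apply/polyP=> i; rewrite coef_poly.
by case: ltnP => // /(leq_trans sp) /leq_sizeP ->.
Qed.

Lemma linear_polyP (f g : {linear {poly F} -> {poly F}}) :
  (forall n, f 'X^n = g 'X^n) -> f =1 g.
Proof.
move=> fg p; rewrite (polyE_widen (leqnn (size p))) !linear_sum.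
by apply: eq_bigr => i _; rewrite !linearZ /= fg.
Qed.

Lemma size_deriv_leq p : (size p^`() <= (size p).-1)%N.
Proof. by rewrite /deriv size_poly. Qed.

Lemma size_derivn_leq p n : (size p^`(n) <= size p - n)%N.
Proof.
rewrite /derivn; elim: n => [|n IH] /=; rewrite ?subn0 // subnS.
by rewrite (leq_trans (size_deriv_leq _)) // -!subn1 leq_sub2r.
Qed.

Lemma op_poly_derivE q N p : (size q <= N)%N ->
  op_poly q (@deriv F) p = \sum_(i < N) q`_i *: p^`(i).
Proof.
move=> sq; rewrite /op_poly (big_ord_widen N (fun i => q`_i *: p^`(i)) sq).
rewrite big_mkcond; apply: eq_bigr => i _; case: ltnP => // /leq_sizeP -> //.
by rewrite scale0r.
Qed.

Lemma op_poly_derivE_size q N p : (size p <= N)%N ->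
  op_poly q (@deriv F) p = \sum_(i < N) q`_i *: p^`(i).
Proof.
move=> sp; rewrite (@op_poly_derivE q (maxn (size q) N)) ?leq_maxl //.
rewrite (big_ord_widen _ (fun i => q`_i *: p^`(i)) (leq_maxr (size q) N)).
rewrite [RHS]big_mkcond; apply: eq_bigr => i _; case: ltnP => // leNi.
have: (size p^`(i) <= 0)%N.
  by apply: leq_trans (size_derivn_leq _ _) _; rewrite leqn0 subn_eq0 (leq_trans sp).
by rewrite leqn0 size_poly_eq0 => /eqP ->; rewrite scaler0.
Qed.

Lemma op_poly_deriv_is_linear q : linear (op_poly q (@deriv F)).
Proof.
move=> a u v; rewrite !(op_poly_derivE _ (leqnn _)) scaler_sumr -big_split /=.
by apply: eq_bigr => i _; rewrite linearP scalerDr !scalerA mulrC.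
Qed.

HB.instance Definition _ q := GRing.isLinear.Build F {poly F} {poly F} *:%R
  (op_poly q (@deriv F)) (op_poly_deriv_is_linear q).

Lemma op_poly_derivC q p :
  op_poly q (@deriv F) p^`() = (op_poly q (@deriv F) p)^`().
Proof.
rewrite !(op_poly_derivE _ (leqnn _)) raddf_sum; apply: eq_bigr => i _.
by rewrite -derivSn /= derivZ -derivnS.
Qed.

Lemma op_poly_op_polyC q r p : op_poly q (@deriv F) (op_poly r (@deriv F) p) =
  op_poly r (@deriv F) (op_poly q (@deriv F) p).
Proof.
rewrite [op_poly q _ p](op_poly_derivE _ (leqnn _)) linear_sum.
rewrite (op_poly_derivE _ (leqnn _)); apply: eq_bigr => i _.
rewrite linearZ /=; congr (_ *: _); elim: {i}(i : nat) => // i IH.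
by rewrite !derivnS op_poly_derivC IH.
Qed.

(** Leibniz' rule gives [D^i X = X D^i + i D^(i-1)], so the commutator of [q(D)] with [X] is
    [q'(D)]. *)
Lemma op_poly_derivMX q p : op_poly q (@deriv F) ('X * p) =
  'X * op_poly q (@deriv F) p + op_poly q^`() (@deriv F) p.
Proof.
(* The sum for [q'] gets one term less: its term [i] pairs with order [i + 1] of [q(D)], while order
   0 commutes with [X]. *)
rewrite !(@op_poly_derivE q (size q).+1) // (@op_poly_derivE _ (size q)); last first.
  exact: leq_trans (size_deriv_leq _) (leq_pred _).
rewrite !big_ord_recl mulrDr -!addrA mulr_sumr -big_split !derivn0 scalerAr /=.
congr (_ + _); apply: eq_bigr => i _.
rewrite add0n -!derivnS ['X * p]mulrC -[p * 'X]addr0 -polyC0 derivnMXaddC.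
rewrite scalerDr addrC.
by rewrite coef_deriv -scalerAr ['X * _]mulrC -scalerMnr scalerMnl.
Qed.

Lemma size_op_poly_deriv q p : (size (op_poly q (@deriv F) p) <= size p)%N.
Proof.
rewrite (op_poly_derivE _ (leqnn _)); apply: (leq_trans (size_sum _ _ _)).
apply/bigmax_leqP=> i _; apply: (leq_trans (size_scale_leq _ _)).
by apply: (leq_trans (size_derivn_leq _ _)); rewrite leq_subr.
Qed.

Lemma size_op_poly_deriv0 q p : q`_0 = 0 ->
  (size (op_poly q (@deriv F) p) <= (size p).-1)%N.
Proof.
move=> q0; rewrite (op_poly_derivE _ (leqnn _)).
apply: (leq_trans (size_sum _ _ _)); apply/bigmax_leqP=> -[[|i] lti] _.
  by rewrite q0 scale0r size_poly0.
apply: (leq_trans (size_scale_leq _ _)).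
by apply: (leq_trans (size_derivn_leq _ _)); rewrite -subn1 leq_sub2l.
Qed.

(** * The exponential of [q(D)] and the Appell polynomials *)

Section Exponential.
Variable q : {poly F}.
Hypothesis q0 : q`_0 = 0.
Notation A := (op_poly q (@deriv F)).
Notation B := (op_poly q^`() (@deriv F)).

Lemma size_iter_op_poly k p : (size (iter k A p) <= size p - k)%N.
Proof.
elim: k => [|k IH] /=; rewrite ?subn0 // subnS.
by rewrite (leq_trans (size_op_poly_deriv0 _ q0)) // -!subn1 leq_sub2r.
Qed.

(** Iterates of [A] from [size p] on vanish, so the series may be cut at any larger index; this lets
    series of polynomials of different sizes be compared. *)
Lemma op_expE N p : (size p <= N)%N ->
  op_exp A p = \sum_(k < N) (k`!%:R)^-1 *: iter k A p.
Proof.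
move=> sp; rewrite /op_exp.
rewrite (big_ord_widen N (fun k => (k`!%:R)^-1 *: iter k A p) sp) big_mkcond.
apply: eq_bigr => i _; case: ltnP => // si.
move: (size_iter_op_poly i p); rewrite (eqP si) leqn0 size_poly_eq0 => /eqP ->.
by rewrite scaler0.
Qed.

(** [[A, X] = B] commutes with [A], hence [[A^k, X] = k B A^(k-1)]. *)
Lemma iter_op_polyMX k p :
  iter k.+1 A ('X * p) = 'X * iter k.+1 A p + B (iter k A p) *+ k.+1.
Proof.
elim: k => [|k IH]; first by rewrite /= op_poly_derivMX.
rewrite iterS IH linearD /= op_poly_derivMX -addrA; congr (_ + _).
by rewrite linearMn /= op_poly_op_polyC [RHS]mulrS.
Qed.

Lemma op_expMX p : op_exp A ('X * p) = 'X * op_exp A p + B (op_exp A p).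
Proof.
(* The two series containing [X] get one extra term: their terms of order [k + 1] differ by
   [(k+1)/(k+1)! = 1/k!] times [B A^k p]. *)
rewrite (@op_expE (size p).+1); last first.
  by rewrite (leq_trans (size_polyMleq _ _)) // size_polyX.
rewrite {1}(@op_expE (size p).+1) // (@op_expE (size p) p) // !big_ord_recl.
rewrite mulrDr -addrA mulr_sumr [B _]linear_sum -big_split /= !fact0 invr1 !scale1r.
congr (_ + _); apply: eq_bigr => i _.
rewrite -iterS iter_op_polyMX scalerDr scalerAr linearZ /=; congr (_ + _).
rewrite /bump add1n -scaler_nat scalerA factS natrM invfM mulrAC.
by rewrite mulVf ?mul1r // Num.Theory.pnatr_eq0.
Qed.

Lemma op_exp_deriv p : op_exp A p^`() = (op_exp A p)^`().
Proof.
rewrite (@op_expE (size p)); last exact: leq_trans (size_deriv_leq _) (leq_pred _).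
rewrite /op_exp raddf_sum; apply: eq_bigr => k _; rewrite /= derivZ; congr (_ *: _).
by elim: {k}(k : nat) => //= k ->; rewrite op_poly_derivC.
Qed.

Lemma op_expZ c p : op_exp A (c *: p) = c *: op_exp A p.
Proof.
rewrite (@op_expE (size p)) ?size_scale_leq // /op_exp scaler_sumr.
apply: eq_bigr => k _; rewrite scalerA mulrC -scalerA; congr (_ *: _).
by elim: {k}(k : nat) => //= k ->; rewrite linearZ.
Qed.

Lemma appell0 : appell q 0 = 1.
Proof.
by rewrite /appell expr0 (@op_expE 1) ?size_poly1 // big_ord1 fact0 invr1 scale1r.
Qed.

Lemma appellS n : appell q n.+1 = 'X * appell q n + B (appell q n).
Proof. by rewrite /appell exprS op_expMX. Qed.

Lemma deriv_appell n : (appell q n)^`() = n%:R *: appell q n.-1.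
Proof. by rewrite /appell -op_exp_deriv derivXn -op_expZ scaler_nat. Qed.

Lemma derivn_appell n j : (appell q n)^`(j) = (n ^_ j)%:R *: appell q (n - j).
Proof.
elim: j => [|j IH]; first by rewrite derivn0 ffactn0 scale1r subn0.
by rewrite derivnS IH derivZ deriv_appell scalerA -natrM -ffactnSr subnS.
Qed.

Lemma appell_monic_size n : appell q n \is monic /\ size (appell q n) = n.+1.
Proof.
elim: n => [|n [mP sP]]; first by rewrite appell0 monic1 size_poly1.
have sX : size ('X * appell q n) = n.+2.
  by rewrite mulrC size_mulX ?sP // monic_neq0.
have lt_sB : (size (B (appell q n)) < size ('X * appell q n)%R)%N.
  by rewrite sX ltnS (leq_trans (size_op_poly_deriv _ _)) ?sP.
rewrite appellS size_polyDl // sX; split=> //.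
by rewrite monicE lead_coefDl // -monicE monicMl ?monicX.
Qed.

(** This expands [q'(D) P_n] by the Appell property of [P_n]. Bounding the orders by the size of
    [P_n], not of [q'], makes the sum run over [j <= n]. *)
Lemma appell_rec n : 'X * appell q n = appell q n.+1 +
  \sum_(j < n.+1) - ((q`_j.+1 *+ j.+1) * (n ^_ j)%:R) *: appell q (n - j).
Proof.
have [_ sP] := appell_monic_size n.
rewrite appellS (@op_poly_derivE_size _ n.+1) ?sP // -addrA -big_split /=.
rewrite big1 ?addr0 // => j _.
by rewrite coef_deriv derivn_appell scalerA -scalerDl subrr scale0r.
Qed.

End Exponential.
End DerivativeOperators.

(** * Falling factorials and the forward difference *)

Section FallingFactorials.
Variable F : numFieldType.
Implicit Types p q : {poly F}.

Lemma fallingSr n : falling n.+1 = falling n * ('X - n%:R%:P) :> {poly F}.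
Proof. by rewrite /falling big_ord_recr. Qed.

Lemma fallingS n : falling n.+1 = 'X * (falling n \Po ('X - 1)) :> {poly F}.
Proof.
rewrite /falling big_ord_recl polyC0 subr0; congr (_ * _).
rewrite rmorph_prod; apply: eq_bigr => i _ /=.
by rewrite comp_polyB comp_polyX comp_polyC -addrA -opprD -polyCD -mulrS.
Qed.

Lemma falling_monic_size n :
  (falling n : {poly F}) \is monic /\ size (falling n : {poly F}) = n.+1.
Proof.
by rewrite monic_prod_XsubC size_prod_XsubC /index_enum -enumT size_enum_ord.
Qed.

Lemma fwd_diff_is_linear : linear (@fwd_diff F).
Proof.
move=> a u v; rewrite /fwd_diff linearP scalerBr opprD.
by rewrite addrACA.
Qed.

HB.instance Definition _ := GRing.isLinear.Build F {poly F} {poly F} *:%R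
  (@fwd_diff F) fwd_diff_is_linear.

Lemma comp_XB1_XD1 p : (p \Po ('X - 1)) \Po ('X + 1) = p.
Proof.
by rewrite -comp_polyA comp_polyB comp_polyX comp_polyC addrK comp_polyXr.
Qed.

Lemma comp_XD1_XB1 p : (p \Po ('X + 1)) \Po ('X - 1) = p.
Proof.
by rewrite -comp_polyA comp_polyD comp_polyX comp_polyC subrK comp_polyXr.
Qed.

(** Compare [(x+1)_(n+1) = (x+1) (x)_n] with [(x)_(n+1) = (x-n) (x)_n]: the linear factors differ by
    [n + 1]. *)
Lemma fwd_diff_falling n : fwd_diff (falling n) = n%:R *: falling n.-1 :> {poly F}.
Proof.
case: n => [|n].
  by rewrite /fwd_diff /falling big_ord0 comp_polyC subrr scale0r.
rewrite /fwd_diff {1}fallingS fallingSr comp_polyM comp_polyX comp_XB1_XD1.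
rewrite [falling n * _]mulrC -mulrBl opprB addrC addrA subrK.
by rewrite -polyC1 -polyCD -mulrSr mul_polyC.
Qed.

End FallingFactorials.

(** * The map [M]: degrees and intertwining relations *)

Section MellinMap.
Variables (F : numFieldType) (M : {linear {poly F} -> {poly F}}).
Hypothesis M_Xn : forall n, M 'X^n = falling n.
Implicit Types p q : {poly F}.

Lemma mellinE N p : (size p <= N)%N -> M p = \sum_(i < N) p`_i *: falling i.
Proof.
move=> sp; rewrite {1}(polyE_widen sp) linear_sum.
by apply: eq_bigr => i _; rewrite linearZ /= M_Xn.
Qed.

Lemma size_mellin_leq p : (size (M p) <= size p)%N.
Proof.
rewrite (mellinE (leqnn _)); apply: (leq_trans (size_sum _ _ _)).
apply/bigmax_leqP=> i _; apply: (leq_trans (size_scale_leq _ _)).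
by have [_ ->] := falling_monic_size F i.
Qed.

(** Falling factorials are monic, so [M] is unitriangular in the monomial basis. *)
Lemma coef_mellin m p : (size p <= m.+1)%N -> (M p)`_m = p`_m.
Proof.
move=> sp; rewrite (mellinE sp) big_ord_recr coefD /= coefZ coef_sum.
have [/monicP fm sf] := falling_monic_size F m.
rewrite lead_coefE sf /= in fm; rewrite fm mulr1 big1 ?add0r // => i _.
rewrite coefZ [(falling i)`_m]nth_default ?mulr0 //.
by have [_ ->] := falling_monic_size F i.
Qed.

Lemma lead_coef_mellin_size p :
  size (M p) = size p /\ lead_coef (M p) = lead_coef p.
Proof.
have [-> | p0] := eqVneq p 0; first by rewrite linear0.
have sp : size p = (size p).-1.+1 by rewrite prednK // lt0n size_poly_eq0.
have c : (M p)`_(size p).-1 = lead_coef p by rewrite coef_mellin // -sp.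
have s : size (M p) = size p.
  apply/eqP; rewrite eqn_leq size_mellin_leq sp ltnNge.
  by apply/negP => /leq_sizeP/(_ _ (leqnn _))/eqP; rewrite c lead_coef_eq0 (negPf p0).
by rewrite lead_coefE s c.
Qed.

Lemma size_mellin p : size (M p) = size p.
Proof. by have [] := lead_coef_mellin_size p. Qed.

Lemma lead_coef_mellin p : lead_coef (M p) = lead_coef p.
Proof. by have [] := lead_coef_mellin_size p. Qed.

Lemma mellin_deriv p : M p^`() = fwd_diff (M p).
Proof.
apply: (linear_polyP (f := M \o @deriv F) (g := @fwd_diff F \o M)) => n /=.
by rewrite derivXn linearMn /= !M_Xn fwd_diff_falling scaler_nat.
Qed.

Lemma mellin_mulX p : M ('X * p) = 'X * (M p \Po ('X - 1)).
Proof.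
rewrite (mellinE (leqnn (size p))).
rewrite {1}(polyE_widen (leqnn (size p))) mulr_sumr linear_sum raddf_sum mulr_sumr.
apply: eq_bigr => i _ /=.
by rewrite -scalerAr -exprS linearZ /= M_Xn fallingS linearZ /= -scalerAr.
Qed.

(** [1 + Delta] is the shift [f(x) |-> f(x+1)], which undoes the shift to [x - 1] in the image of
    multiplication by [X]. *)
Lemma mulX_mellin p : 'X * M p = M ('X * (p + p^`())).
Proof.
by rewrite mellin_mulX linearD /= mellin_deriv /fwd_diff addrCA subrr addr0 comp_XD1_XB1.
Qed.

Lemma mellin_Xderiv p : M ('X * p^`()) = - ('X * bwd_diff (M p)).
Proof.
by rewrite mellin_mulX mellin_deriv /fwd_diff comp_polyB comp_XD1_XB1 -mulrN opprB.
Qed.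

(** This is the first-order rule applied to the derivative of [p], with
    [- nabla Delta = Delta + nabla]. *)
Lemma mellin_Xderiv2 p :
  M ('X * p^`(2)) = 'X * fwd_diff (M p) + 'X * bwd_diff (M p).
Proof.
rewrite derivSn derivn1 mellin_Xderiv mellin_deriv /fwd_diff /bwd_diff.
by rewrite comp_polyB comp_XD1_XB1 -mulrN -mulrDr !opprB.
Qed.

Lemma mellin_op_poly q p :
  M (op_poly q (@deriv F) p) = op_poly q (@fwd_diff F) (M p).
Proof.
rewrite linear_sum; apply: eq_bigr => i _; rewrite linearZ /=; congr (_ *: _).
by elim: {i}(i : nat) => //= i <-; rewrite mellin_deriv.
Qed.

(** [M] preserves sizes, so both exponential sums stop at the same index and match term by term. *)
Lemma mellin_appell q n : M (appell q n) = charlier_appell q n.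
Proof.
rewrite /appell /charlier_appell /op_exp -M_Xn size_mellin linear_sum.
apply: eq_bigr => k _; rewrite linearZ /=; congr (_ *: _).
by elim: {k}(k : nat) => //= k <-; rewrite mellin_op_poly.
Qed.

End MellinMap.

(** * Uniqueness of recurrences and [d]-orthogonality *)

Section Recurrences.
Variable F : numFieldType.
Implicit Types (p q : {poly F}) (P : nat -> {poly F}).

Lemma triangular_free P (c : nat -> F) m : (forall n, size (P n) = n.+1) ->
  \sum_(i < m) c i *: P i = 0 -> forall i, (i < m)%N -> c i = 0.
Proof.
move=> sP; elim: m => // m IH sum0 i; rewrite ltnS.
have cm0 : c m = 0.
  move/(congr1 (fun p => p`_m)): (sum0); rewrite big_ord_recr coefD coef0 coef_sum.
  rewrite big1 => [|j _]; last by rewrite coefZ [(P j)`_m]nth_default ?mulr0 ?sP.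
  move/eqP; rewrite add0r coefZ mulf_eq0 => /orP[/eqP //|].
  by have := lead_coef_eq0 (P m); rewrite lead_coefE -size_poly_eq0 sP /= => ->.
rewrite leq_eqVlt => /orP[/eqP -> //|]; apply: IH.
by rewrite big_ord_recr /= cm0 scale0r addr0 in sum0.
Qed.

Lemma band_sumE d n P (gamma : nat -> nat -> F) :
  \sum_(j < d.+1 | (j <= n)%N) gamma j n *: P (n - j)%N =
  \sum_(j < n.+1) (if (j <= d)%N then gamma j n else 0) *: P (n - j)%N.
Proof.
pose G j := gamma j n *: P (n - j)%N.
rewrite (big_ord_widen_cond (maxn d n).+1 (fun j => j <= n)%N G) ?ltnS ?leq_maxl //.
transitivity (\sum_(j < n.+1 | (j <= d)%N) G j).
  rewrite (big_ord_widen_cond (maxn d n).+1 (fun j => j <= d)%N G) ?ltnS ?leq_maxr //.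
  by apply: eq_bigl => j; rewrite andbC !ltnS.
rewrite big_mkcond; apply: eq_bigr => j _; case: ifP => //.
by rewrite scale0r.
Qed.

(** Polynomials of distinct degrees are independent, so recurrence coefficients are unique and any
    explicit full recurrence decides [d]-orthogonality. *)
Lemma d_orthogonalP d P (g : nat -> nat -> F) :
    (forall n, P n \is monic /\ size (P n) = n.+1) ->
    (forall n, 'X * P n = P n.+1 + \sum_(j < n.+1) g j n *: P (n - j)%N) ->
  d_orthogonal d P <->
  (forall n j, (d < j <= n)%N -> g j n = 0) /\ (forall n, (d <= n)%N -> g d n != 0).
Proof.
move=> mP recP; split=> [[_ [gamma [recG gam0]]] | [g0 gd]]; last first.
  split=> //; exists g; split=> // n; rewrite recP band_sumE; congr (_ + _).
  apply: eq_bigr => j _; case: leqP => // ltdj.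
  by rewrite g0 // ltdj -ltnS ltn_ord.
have gE n j : (j <= n)%N -> g j n = if (j <= d)%N then gamma j n else 0.
  move=> lejn; pose c j := g j n - (if (j <= d)%N then gamma j n else 0).
  (* Reindexing by the degree [i = n - j] gives the form required by linear independence. *)
  have sum0 : \sum_(i < n.+1) c (n - i)%N *: P i = 0.
    have := recG n; rewrite recP band_sumE => /addrI/eqP; rewrite -subr_eq0 => /eqP.
    rewrite -sumrB => {2}<-; rewrite (reindex_inj rev_ord_inj); apply: eq_bigr => i _ /=.
    by rewrite subSS -scalerBl subKn // -ltnS.
  have sP m : size (P m) = m.+1 by have [] := mP m.
  have := triangular_free (c := fun i => c (n - i)%N) sP sum0 (i := (n - j)%N).
  by rewrite ltnS leq_subr subKn // => /(_ isT)/eqP; rewrite subr_eq0 => /eqP.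
split=> [n j /andP[ltdj lejn] | n ledn]; first by rewrite gE // leqNgt ltdj.
by rewrite gE // leqnn gam0.
Qed.

Lemma size_poly_eqP p m :
  size p = m.+1 <-> p`_m != 0 /\ (forall j, (m < j)%N -> p`_j = 0).
Proof.
split=> [sp | [pm pj]].
  split=> [|j ltmj]; last by rewrite nth_default ?sp.
  by have := lead_coef_eq0 p; rewrite lead_coefE -size_poly_eq0 sp /= => ->.
apply/eqP; rewrite eqn_leq; apply/andP; split; first exact/leq_sizeP.
by rewrite ltnNge; apply: contra pm => /leq_sizeP ->.
Qed.

Lemma ffact_natr_neq0 n j : (j <= n)%N -> (n ^_ j)%:R != 0 :> F.
Proof. by rewrite Num.Theory.pnatr_eq0 -lt0n ffact_gt0. Qed.

Lemma mulrSn_eq0 (x : F) n : (x *+ n.+1 == 0) = (x == 0).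
Proof. exact: Num.Theory.mulrn_eq0. Qed.

(** In characteristic 0, for [j <= n], the coefficient of [P_(n-j)] is a nonzero multiple of
    [q_(j+1)]; the last nonzero one therefore reveals the degree of [q]. *)
Lemma appell_d_orthogonal q d : q`_0 = 0 ->
  d_orthogonal d (appell q) <-> size q = d.+2.
Proof.
move=> q0; rewrite (d_orthogonalP _ (g := fun j n => - (q`_j.+1 *+ j.+1 * (n ^_ j)%:R)));
  last first.
- by move=> n; rewrite (appell_rec q0).
- by move=> n; exact: appell_monic_size.
rewrite size_poly_eqP; split=> [[q_hi q_d] | [q_d q_hi]].
  split=> [|[//|j] ltdj].
    have := q_d d (leqnn d); rewrite oppr_eq0 mulf_eq0 negb_or mulrSn_eq0.
    by case/andP.
  have := q_hi j j; rewrite leqnn andbT => /(_ ltdj)/eqP.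
  rewrite oppr_eq0 mulf_eq0 (negPf (ffact_natr_neq0 _)) ?orbF //.
  by rewrite mulrSn_eq0 => /eqP.
split=> [n j /andP[ltdj lejn] | n ledn].
  by rewrite q_hi ?ltnS // mul0rn mul0r oppr0.
by rewrite oppr_eq0 mulf_neq0 ?mulrSn_eq0 ?ffact_natr_neq0.
Qed.

(** * Recurrence of the Charlier-Appell polynomials *)

Section CharlierAppell.
Variable M : {linear {poly F} -> {poly F}}.
Hypothesis M_Xn : forall n, M 'X^n = falling n.

(** For [j >= 1] the part with [q_j] is [n gamma_(j-1)(n-1)], [gamma] being the Appell coefficients,
    simplified by [n (n-1)_(j-1) = (n)_j]. *)
Definition charlier_appell_coef q (j n : nat) : F :=
  (if j == 0 then n%:R else 0)
    - (q`_j.+1 *+ j.+1 + q`_j *+ j) * (n ^_ j)%:R.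

(* As [X] acts on the image of [M] as [X (1 + D)] does on the source, the new
   coefficients are [gamma_j(n) + n gamma_(j-1)(n - 1)], with
   [gamma_(-1) = 1]. *)
Lemma charlier_appell_rec q n : q`_0 = 0 ->
  'X * charlier_appell q n = charlier_appell q n.+1 +
    \sum_(j < n.+1) charlier_appell_coef q j n *: charlier_appell q (n - j).
Proof.
move=> q0; pose g j n : F := - (q`_j.+1 *+ j.+1 * (n ^_ j)%:R).
pose S n := \sum_(j < n.+1) g j n *: charlier_appell q (n - j).
have MX k : M ('X * appell q k) = charlier_appell q k.+1 + S k.
  rewrite (appell_rec q0) linearD /= (mellin_appell M_Xn) linear_sum.
  congr (_ + _); apply: eq_bigr => j _.
  by rewrite linearZ /= (mellin_appell M_Xn).
rewrite -(mellin_appell M_Xn q n) (mulX_mellin M_Xn) mulrDr linearD /= MX -addrA.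
congr (_ + _); rewrite (deriv_appell q0) -scalerAr linearZ /= MX.
case: n => [|n] /=.
  rewrite scale0r addr0 /S !big_ord1 /g /charlier_appell_coef /=.
  by rewrite mulr0n addr0 sub0r.
(* The derivative contributes its leading polynomial to [j = 0] and its recurrence sum, shifted by
   one, to [j >= 1]. *)
rewrite /S [\sum_(j < n.+2) g _ _ *: _]big_ord_recl [RHS]big_ord_recl.
rewrite scalerDr [_ *: \sum_(j < _) _ *: charlier_appell _ _]scaler_sumr.
rewrite addrACA subn0 -scalerDl -big_split /=.
congr (_ *: _ + _).
  by rewrite /g /charlier_appell_coef /= ffactn0 mulr0n addr0 mulr1 addrC.
apply: eq_bigr => j _; rewrite /bump add1n subSS scalerA -scalerDl; congr (_ *: _).
rewrite /g /charlier_appell_coef /= sub0r mulrN -opprD [in RHS]mulrDl; congr (- (_ + _)).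
by rewrite mulrCA -natrM ffactSS.
Qed.

(** For [1 <= j <= n] the coefficient vanishes exactly when [(j+1) q_(j+1) + j q_j = 0]. Beyond the
    band this only ties consecutive coefficients of [q] together; finiteness of [q] then makes them
    zero. *)
Lemma charlier_appell_d_orthogonal q d : q`_0 = 0 ->
  d_orthogonal d.+1 (charlier_appell q) <-> size q = d.+2.
Proof.
move=> q0; rewrite (d_orthogonalP _ (g := charlier_appell_coef q)); last first.
- by move=> n; exact: charlier_appell_rec.
- move=> n; rewrite -(mellin_appell M_Xn) monicE (size_mellin M_Xn).
  by rewrite (lead_coef_mellin M_Xn) -monicE; exact: appell_monic_size.
have coef_eq0 j n : (j < n)%N ->
    (charlier_appell_coef q j.+1 n == 0) = (q`_j.+2 *+ j.+2 + q`_j.+1 *+ j.+1 == 0).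
  move=> ltjn; rewrite /charlier_appell_coef sub0r oppr_eq0 mulf_eq0.
  by rewrite (negPf (ffact_natr_neq0 ltjn)) orbF.
rewrite size_poly_eqP; split=> [[q_hi q_d] | [q_d q_hi]]; last first.
  split=> [n [|j] /andP[// ltdj lejn] | n ledn].
    by apply/eqP; rewrite coef_eq0 // !q_hi ?mul0rn ?addr0 // ltnW.
  by rewrite coef_eq0 // q_hi ?mul0rn ?add0r ?mulrSn_eq0.
have step j : (d < j)%N -> q`_j.+2 = 0 -> q`_j.+1 = 0.
  move=> ltdj qj; have := q_hi j.+1 j.+1; rewrite leqnn andbT => /(_ ltdj)/eqP.
  by rewrite coef_eq0 // qj mul0rn add0r mulrSn_eq0 => /eqP.
(* Induction descends from [size q]. As a power series, [log(1 + x)] also satisfies the relation, so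
   it matters that [q] is a polynomial. *)
have qj0 : forall j, (d < j)%N -> q`_j.+1 = 0.
  move=> j; have [k] := ubnP (size q - j); elim: k j => // k IH j lek ltdj.
  have [lesj | ltjs] := leqP (size q) j.+1; first by rewrite nth_default.
  apply: step => //; apply: IH; last exact: ltnW.
  by rewrite subnS; case: (size q - j)%N (subn_gt0 j (size q)) lek => //;
    rewrite (ltnW ltjs).
split=> [|[//|j]]; last exact: qj0.
have := q_d d.+1 (leqnn _); rewrite coef_eq0 // (qj0 d.+1) //.
by rewrite mul0rn add0r mulrSn_eq0.
Qed.

End CharlierAppell.
End Recurrences.

(** * Eigenfunctions and their transfer along intertwining maps *)

Section EigenSystems.
Variable F : numFieldType.
Implicit Types (p q : {poly F}) (P Q : nat -> {poly F}) (L : {poly F} -> {poly F}).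

Lemma eigen_system_ext L1 L2 P Q :
  L1 =1 L2 -> P =1 Q -> eigen_system L1 P -> eigen_system L2 Q.
Proof. by move=> eqL eqPQ eigP n; rewrite -eqPQ -eqL; exact: eigP. Qed.

Section Transfer.
Variables (T : {linear {poly F} -> {poly F}}) (L1 L2 : {poly F} -> {poly F}) (s : F).
Hypotheses (size_T : forall p, size (T p) = size p) (s0 : s != 0).
Hypothesis L2T : forall p, L2 (T p) = s *: T (L1 p).

(** Preserving sizes, [T] has trivial kernel, so eigenvalue equations can be pulled back;
    eigenvalues are multiplied by [s]. *)
Lemma eigen_system_transfer P :
  eigen_system L1 P <-> eigen_system L2 (fun n => T (P n)).
Proof.
split=> eigP n; have [sP [l LP]] := eigP n.
  by split; [rewrite size_T | exists (s * l); rewrite L2T LP linearZ scalerA].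
split; first by rewrite -size_T.
exists (s^-1 * l); apply/(scalerI s0)/eqP; rewrite scalerA mulVKf // -subr_eq0.
rewrite -size_poly_eq0 -size_T linearB [T (s *: _)]linearZ [T (l *: _)]linearZ /=.
by rewrite -L2T LP subrr size_poly0.
Qed.

Lemma eigen_system_image Q : bijective T ->
  eigen_system L2 Q <->
  exists P, eigen_system L1 P /\ (forall n, Q n = T (P n)).
Proof.
case=> T' _ T'K; split=> [eigQ | [P [eigP QE]]].
  exists (T' \o Q); split=> [|n] /=; last by rewrite T'K.
  by apply/eigen_system_transfer; apply: eigen_system_ext eigQ => // n /=; rewrite T'K.
move/eigen_system_transfer: eigP; exact: eigen_system_ext.
Qed.

End Transfer.

Definition appell_op q p := 'X * p^`() + op_poly q^`() (@deriv F) p^`().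

Lemma appell_op_is_linear q : linear (appell_op q).
Proof.
move=> a u v; rewrite /appell_op derivD derivZ mulrDr linearP -scalerAr scalerDr.
by rewrite addrACA.
Qed.

HB.instance Definition _ q := GRing.isLinear.Build F {poly F} {poly F} *:%R
  (appell_op q) (appell_op_is_linear q).

(** Only [X D] reaches the top degree, since [q'(D) D] lowers degrees; this ties the eigenvalue to
    the degree. *)
Lemma coef_appell_op q p m : (size p <= m.+1)%N ->
  (appell_op q p)`_m = m%:R * p`_m.
Proof.
move=> sp; have sp' : (size p^`() <= m)%N.
  by rewrite (leq_trans (size_deriv_leq _)) // -subn1 leq_subLR.
rewrite coefD coefXM coef_deriv [X in _ + X]nth_default ?addr0; last first.
  exact: leq_trans (size_op_poly_deriv _ _) sp'.
by case: m {sp sp'} => [|m]; rewrite ?mul0r // mulr_natl.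
Qed.

Lemma appell_op_appell q n : q`_0 = 0 ->
  appell_op q (appell q n) = n%:R *: appell q n.
Proof.
move=> q0; rewrite /appell_op (deriv_appell q0) -scalerAr linearZ /= -scalerDr.
by case: n => [|n]; rewrite ?scale0r //= -appellS.
Qed.

Lemma appell_op_eigenvalue q p n l : size p = n.+1 ->
  appell_op q p = l *: p -> l = n%:R.
Proof.
move=> sp /(congr1 (fun r : {poly F} => r`_n)); rewrite coef_appell_op ?sp // coefZ.
have [pn _] := (size_poly_eqP p n).1 sp.
by move/(mulIf pn) ->.
Qed.

(** Subtracting a multiple of the Appell polynomial cancels the leading term. The remainder keeps
    eigenvalue [n] but has degree below [n], so it is zero. *)
Lemma appell_op_unique q p n l : q`_0 = 0 -> size p = n.+1 ->
  appell_op q p = l *: p -> p = lead_coef p *: appell q n.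
Proof.
move=> q0 sp eqp; have lE := appell_op_eigenvalue sp eqp.
apply/eqP; rewrite -subr_eq0; set r := _ - _.
have Lr : appell_op q r = n%:R *: r.
  by rewrite /r linearB linearZ /= appell_op_appell // eqp lE scalerBr scalerA mulrC
    -scalerA.
have [mP sP] := appell_monic_size q0 n.
have sr : (size r <= n)%N.
  apply/leq_sizeP => j; rewrite leq_eqVlt coefB coefZ => /orP[/eqP <- | ltnj].
    have -> : (appell q n)`_n = 1 by move/monicP: mP; rewrite lead_coefE sP.
    by rewrite mulr1 lead_coefE sp subrr.
  by rewrite !nth_default ?sp ?sP // mulr0 subrr.
case sE: (size r) => [|m]; first by rewrite -size_poly_eq0 sE.
move/eqP: (appell_op_eigenvalue sE Lr); rewrite Num.Theory.eqr_nat => /eqP nE.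
by rewrite sE nE ltnn in sr.
Qed.

Lemma eigen_appell_op q P : q`_0 = 0 ->
  eigen_system (appell_op q) P <->
  exists k : nat -> F, forall n, k n != 0 /\ P n = k n *: appell q n.
Proof.
move=> q0; split=> [eigP | [k kP] n].
  exists (fun n => lead_coef (P n)) => n; have [sP [l LP]] := eigP n.
  by split; [rewrite lead_coef_eq0 -size_poly_eq0 sP | exact: appell_op_unique LP].
have [k0 ->] := kP n; have [_ sP] := appell_monic_size q0 n.
split; first by rewrite size_scale.
by exists n%:R; rewrite linearZ /= appell_op_appell // !scalerA mulrC.
Qed.

(** For [q = - x^2/2] one has [q'(D) D = - D^2]. *)
Lemma hermite_opE p : hermite_op p = appell_op (- 2^-1 *: 'X^2) p.
Proof.
rewrite /hermite_op /appell_op addrC; congr (_ + _).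
have -> : (- 2^-1 *: 'X^2)^`() = - 'X :> {poly F}.
  rewrite derivZ derivXn -scaler_nat scalerA mulNr mulVf ?scaleN1r //.
  by rewrite Num.Theory.pnatr_eq0.
rewrite (@op_poly_derivE _ _ 2) ?size_polyN ?size_polyX // big_ord_recl big_ord1.
by rewrite !coefN !coefX /= oppr0 scale0r add0r scaleN1r.
Qed.

Lemma appell_op_scaleX a p : appell_op (a *: 'X) p = 'X * p^`() + a *: p^`().
Proof.
rewrite /appell_op derivZ derivX alg_polyC (@op_poly_derivE _ _ 1) ?size_polyC_leq1 //.
by rewrite big_ord1 coefC.
Qed.

Lemma d_orthogonal_ext d P Q : P =1 Q -> d_orthogonal d P -> d_orthogonal d Q.
Proof.
move=> eqPQ [mP [gamma [recP gam0]]]; split=> [n|]; first by rewrite -eqPQ.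
exists gamma; split=> // n; rewrite -!eqPQ recP; congr (_ + _).
by apply: eq_bigr => j _; rewrite eqPQ.
Qed.

Lemma monic_ofZ k p : k != 0 -> p \is monic -> monic_of (k *: p) = p.
Proof.
move=> k0 /monicP mp.
by rewrite /monic_of lead_coefZ mp mulr1 scalerA mulVf // scale1r.
Qed.

(** * Images of the classical families *)

Section MellinEigenSystems.
Variable M : {linear {poly F} -> {poly F}}.
Hypothesis M_Xn : forall n, M 'X^n = falling n.

(** Here [q] has degree 2, that is [d = 1]; [monic_of] removes the scalars that the eigenvalue
    problem leaves free. *)
Lemma hermite_image_d_orthogonal H : eigen_system (@hermite_op F) H ->
  d_orthogonal 2 (fun n => monic_of (M (H n))).
Proof.
have q0 : (- 2^-1 *: 'X^2 : {poly F})`_0 = 0 by rewrite coefZ coefXn mulr0.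
move/(eigen_system_ext hermite_opE (frefl H))/(eigen_appell_op _ q0) => [k kH].
apply: (@d_orthogonal_ext _ (charlier_appell (- 2^-1 *: 'X^2))) => [n|].
  have [k0 ->] := kH n; have [mP _] := appell_monic_size q0 n.
  rewrite linearZ /= monic_ofZ ?(mellin_appell M_Xn) //.
  by rewrite -(mellin_appell M_Xn) monicE (lead_coef_mellin M_Xn).
apply/(charlier_appell_d_orthogonal M_Xn _ q0).
by rewrite size_scale ?size_polyXn // oppr_eq0 invr_eq0 Num.Theory.pnatr_eq0.
Qed.

Lemma charlier_op_mellin a p :
  charlier_op (- a) (M p) = -1 *: M (appell_op (a *: 'X) p).
Proof.
rewrite appell_op_scaleX linearD linearZ /= (mellin_Xderiv M_Xn) (mellin_deriv M_Xn).
by rewrite /charlier_op scaleN1r opprD opprK addrC scaleNr.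
Qed.

Lemma charlier_image a C : bijective M ->
  eigen_system (charlier_op (- a)) C <->
  exists k : nat -> F, forall n, k n != 0 /\ C n = k n *: M (appell (a *: 'X) n).
Proof.
move=> bijM; have N1 : -1 != 0 :> F by rewrite oppr_eq0 oner_eq0.
have q0 : (a *: 'X : {poly F})`_0 = 0 by rewrite coefZ coefX mulr0.
rewrite (eigen_system_image (size_mellin M_Xn) N1 (charlier_op_mellin a) _ bijM).
split=> [[P [/(eigen_appell_op _ q0)[k kP] CE]] | [k kC]].
  by exists k => n; have [k0 PE] := kP n; rewrite CE PE linearZ.
exists (fun n => k n *: appell (a *: 'X) n); split=> [|n].
  by apply/(eigen_appell_op _ q0); exists k => n; have [] := kC n.
by rewrite linearZ /=; have [] := kC n.
Qed.

(** Write the operator as [c (x (Delta + nabla) + beta Delta) + (1 - c) x nabla], whose pieces are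
    known images. *)
Lemma meixner_op_mellin beta c p : meixner_op beta c (M p) =
  M (c *: ('X * p^`(2) + beta *: p^`()) - (1 - c) *: ('X * p^`())).
Proof.
rewrite linearB !linearZ linearD linearZ /= (mellin_Xderiv2 M_Xn).
rewrite (mellin_deriv M_Xn) (mellin_Xderiv M_Xn) /meixner_op.
by rewrite -!mul_polyC polyCB polyC1; ring.
Qed.

(** In the variable [s t], the part [c (t D^2 + beta D)] gains the factor [c s = 1 - c], which is
    also the factor of [t D]: this dictates [s]. *)
Lemma meixner_op_laguerre beta c p : c != 0 ->
  meixner_op beta c (M (p \Po (((1 - c) / c) *: 'X))) =
  (c - 1) *: M (laguerre_op (beta - 1) p \Po (((1 - c) / c) *: 'X)).
Proof.
move=> c0; rewrite meixner_op_mellin -[RHS]linearZ; congr (M _).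
set s := (1 - c) / c; have sc : 1 - c = s * c by rewrite divfK.
have dE r : (r \Po (s *: 'X))^`() = s *: (r^`() \Po (s *: 'X)).
  by rewrite deriv_comp derivZ derivX alg_polyC mulrC mul_polyC.
rewrite derivSn derivn1 dE derivZ dE /laguerre_op derivSn derivn1.
(* With [1 - c] replaced by [s c] and [s] made opaque, a division-free identity remains for
   [ring]. *)
rewrite -[c - 1]opprB sc; clearbody s.
rewrite comp_polyB [(- _) \Po _]raddfN /= !comp_polyM comp_polyB comp_polyX.
rewrite comp_polyC subrK -!mul_polyC !polyCN !polyCM.
ring.
Qed.

Lemma meixner_image_half alpha P :
  eigen_system (laguerre_op alpha) P <->
  eigen_system (meixner_op (alpha + 1) 2^-1) (fun n => M (P n)).
Proof.
have two0 : 2 != 0 :> F by rewrite Num.Theory.pnatr_eq0.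
have s1 : (1 - 2^-1) / 2^-1 = 1 :> F by field.
have c1 : 2^-1 - 1 != 0 :> F.
  have -> : 2^-1 - 1 = - 2^-1 :> F by field.
  by rewrite oppr_eq0 invr_eq0.
apply: (eigen_system_transfer (size_mellin M_Xn) c1) => p.
have := meixner_op_laguerre (alpha + 1) p (invr_neq0 two0).
by rewrite s1 scale1r !comp_polyXr addrK.
Qed.

(** As [c != 1], the dilation by [s] is invertible, so its composite with [M] is a size-preserving
    bijection. *)
Lemma meixner_image beta c Q : bijective M -> c != 0 -> c != 1 ->
  eigen_system (meixner_op beta c) Q <->
  exists P, eigen_system (laguerre_op (beta - 1)) P /\
    forall n, Q n = M (P n \Po (((1 - c) / c) *: 'X)).
Proof.
move=> bijM c0 c1; set s := (1 - c) / c.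
have s0 : s != 0 by rewrite mulf_neq0 ?invr_neq0 // subr_eq0 eq_sym.
have c10 : c - 1 != 0 by rewrite subr_eq0.
have comp_scaleXK a b : a * b = 1 ->
    cancel (comp_poly (a *: 'X : {poly F})) (comp_poly (b *: 'X)).
  move=> ab p; rewrite -comp_polyA comp_polyZ comp_polyX scalerA ab scale1r.
  exact: comp_polyXr.
apply: (eigen_system_image (T := M \o comp_poly (s *: 'X)) _ c10) => [p|p|] /=.
- by rewrite (size_mellin M_Xn) size_comp_poly2 // size_scale ?size_polyX.
- exact: meixner_op_laguerre.
- apply: (bij_comp bijM); exists (comp_poly (s^-1 *: 'X)); apply: comp_scaleXK.
    by rewrite mulfV.
  by rewrite mulVf.
Qed.

End MellinEigenSystems.
End EigenSystems.

Theorem corollary6p3 (R : realType)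
    (M : {linear {poly R[i]} -> {poly R[i]}})
    (M_iso : bijective M)
    (M_Xn : forall n : nat, M 'X^n = falling n) :
  (* (i) *)
  ((forall q : {poly R[i]}, q`_0 = 0 ->
      (forall n : nat, M (appell q n) = charlier_appell q n) /\
      (forall d : nat,
         d_orthogonal d (appell q) <->
         d_orthogonal d.+1 (charlier_appell q))) /\
   (forall H : nat -> {poly R[i]}, eigen_system (@hermite_op _) H ->
      d_orthogonal 2 (fun n => monic_of (M (H n)))) /\
   (* Charlier(rho) is the image of the Appell member q = a X with a = - rho *)
   (forall (a : R[i]) (C : nat -> {poly R[i]}),
      eigen_system (charlier_op (- a)) C <->
      exists k : nat -> R[i],
        forall n, k n != 0 /\ C n = k n *: M (appell (a *: 'X) n)))
  /\
  (* (ii) *)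
  ((forall (alpha : R[i]) (P : nat -> {poly R[i]}),
      eigen_system (laguerre_op alpha) P <->
      eigen_system (meixner_op (alpha + 1) 2^-1) (fun n => M (P n))) /\
   (* the Meixner polynomials for arbitrary c: Laguerre in the variable s t,
      with s = (1 - c) / c (s = 1 for c = 1/2) *)
   (forall beta c : R[i], c != 0 -> c != 1 ->
      forall Q : nat -> {poly R[i]},
        eigen_system (meixner_op beta c) Q <->
        exists P : nat -> {poly R[i]},
          eigen_system (laguerre_op (beta - 1)) P /\
          forall n, Q n = M (P n \Po (((1 - c) / c) *: 'X)))).
Proof.
split; split.
- move=> q q0; split=> [n | d]; first exact: mellin_appell.
  by rewrite (appell_d_orthogonal d q0) (charlier_appell_d_orthogonal M_Xn d q0).
- split=> [H | a C]; first exact: hermite_image_d_orthogonal.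
  exact: charlier_image.
- by move=> alpha P; exact: meixner_image_half.
- by move=> beta c c0 c1 Q; exact: meixner_image.
Qed.
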